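(* Let $R$ be a unital ring. There is a one-to-one correspondence between bivariant Sylvester module rank functions for $R$ and extended Sylvester map rank functions for $R$, given by the following two mutually inverse constructions. (1) Let $\mathrm{rk}$ be an extended Sylvester map rank function for $R$. For $R$-modules $\mathcal{M}_1\subseteq\mathcal{M}_2$ define $\dim(\mathcal{M}_1|\mathcal{M}_2):=\mathrm{rk}(\gamma_{\mathcal{M}_1\subseteq\mathcal{M}_2})$, where $\gamma_{\mathcal{M}_1\subseteq\mathcal{M}_2}$ is the embedding map $\mathcal{M}_1\hookrightarrow\mathcal{M}_2$. Then $\dim(\cdot|\cdot)$ is a bivariant Sylvester module rank function for $R$. (2) Let $\dim(\cdot|\cdot)$ be a bivariant Sylvester module rank function for $R$. For any map $\alpha:\mathcal{M}_1\to\mathcal{M}_2$ of $R$-modules define $\mathrm{rk}(\alpha):=\dim(\mathrm{im}(\alpha)|\mathcal{M}_2)$. Then $\mathrm{rk}$ is an extended Sylvester map rank function for $R$.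
   Context: All modules are left modules; maps between modules are module homomorphisms, written on the right of their arguments, so $\alpha\beta$ means first $\alpha$, then $\beta$. A bivariant Sylvester module rank function for $R$ is an $\mathbb{R}_{\ge 0}\cup\{+\infty\}$-valued function $(\mathcal{M}_1,\mathcal{M}_2)\mapsto\dim(\mathcal{M}_1|\mathcal{M}_2)$ on the class of all pairs of $R$-modules $\mathcal{M}_1\subseteq\mathcal{M}_2$ ($\mathcal{M}_1$ a submodule of $\mathcal{M}_2$) such that: (1) $\dim(\mathcal{M}_1|\mathcal{M}_2)$ is an isomorphism invariant of the pair; (2) writing $\dim(\mathcal{M}):=\dim(\mathcal{M}|\mathcal{M})$, one has $\dim(0)=0$ and $\dim(R)=1$; (3) $\dim(\mathcal{M}_1\oplus\mathcal{M}_3|\mathcal{M}_2\oplus\mathcal{M}_4)=\dim(\mathcal{M}_1|\mathcal{M}_2)+\dim(\mathcal{M}_3|\mathcal{M}_4)$ for all $\mathcal{M}_1\subseteq\mathcal{M}_2$, $\mathcal{M}_3\subseteq\mathcal{M}_4$; (4) $\dim(\mathcal{M}_1|\mathcal{M}_2)=\sup_{\mathcal{M}_1'}\dim(\mathcal{M}_1'|\mathcal{M}_2)$, with $\mathcal{M}_1'$ ranging over all finitely generated submodules of $\mathcal{M}_1$; (5) if $\mathcal{M}_1$ is finitely generated, $\dim(\mathcal{M}_1|\mathcal{M}_2)=\inf_{\mathcal{M}_2'}\dim(\mathcal{M}_1|\mathcal{M}_2')$, with $\mathcal{M}_2'$ ranging over all finitely generated submodules of $\mathcal{M}_2$ containing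 $\mathcal{M}_1$; (6) $\dim(\mathcal{M}_2)=\dim(\mathcal{M}_1|\mathcal{M}_2)+\dim(\mathcal{M}_2/\mathcal{M}_1)$ for all $\mathcal{M}_1\subseteq\mathcal{M}_2$. An extended Sylvester map rank function for $R$ is an $\mathbb{R}_{\ge 0}\cup\{+\infty\}$-valued function $\mathrm{rk}$ on the class of all maps between $R$-modules such that: (1) $\mathrm{rk}(0)=0$, $\mathrm{rk}(\mathrm{id}_R)=1$; (2) $\mathrm{rk}(\alpha\beta)\le\min(\mathrm{rk}(\alpha),\mathrm{rk}(\beta))$ for composable maps; (3) $\mathrm{rk}(\alpha\oplus\beta)=\mathrm{rk}(\alpha)+\mathrm{rk}(\beta)$; (4) if $(\mathcal{M}_j,\beta_{jk})$ is a direct system of $R$-modules over a directed set $J$ with direct limit $\mathcal{M}_\infty$ and canonical maps $\beta_j:\mathcal{M}_j\to\mathcal{M}_\infty$, and $\alpha_j:\mathcal{M}_j\to\mathcal{M}$, $\alpha_\infty:\mathcal{M}_\infty\to\mathcal{M}$ are maps to an $R$-module $\mathcal{M}$ with $\beta_{jk}\alpha_k=\alpha_j$ for $j\le k$ and $\beta_j\alpha_\infty=\alpha_j$ for all $j$, then $\mathrm{rk}(\alpha_\infty)=\lim_{j\to\infty}\mathrm{rk}(\alpha_j)$; (5) if $(\mathcal{M}_j,\beta_{jk})$, $\mathcal{M}_\infty$, $\beta_j$ are as in (4), and $\alpha_j:\mathcal{M}\to\mathcal{M}_j$, $\alpha_\infty:\mathcal{M}\to\mathcal{M}_\infty$ are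 maps from a finitely generated $R$-module $\mathcal{M}$ with $\alpha_j\beta_{jk}=\alpha_k$ for $j\le k$ and $\alpha_j\beta_j=\alpha_\infty$ for all $j$, then $\mathrm{rk}(\alpha_\infty)=\lim_{j\to\infty}\mathrm{rk}(\alpha_j)$; (6) for any map $\alpha:\mathcal{M}_1\to\mathcal{M}_2$, $\mathrm{rk}(\mathrm{id}_{\mathcal{M}_2})=\mathrm{rk}(\alpha)+\mathrm{rk}(\mathrm{id}_{\mathrm{coker}(\alpha)})$. *)

(* Defs.v *)
From HB Require Import structures.
From mathcomp Require Import all_boot all_order all_algebra.
From mathcomp Require Import all_classical all_reals all_analysis.
From mathcomp Require Import generic_quotient ring_quotient.

Set Implicit Arguments.
Unset Strict Implicit.
Unset Printing Implicit Defensive.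

Import Order.TTheory GRing.Theory Num.Theory.
Import numFieldNormedType.Exports.

Local Open Scope classical_set_scope.
Local Open Scope ring_scope.

(* Throughout, a left R-module is an [lmodType R] and a submodule of M is a
   [submodClosed M], i.e. a boolean predicate on M closed under the operations.
   Classically every subset is a boolean predicate and every type has a choice
   structure, so no submodule or module is left out. *)

Section Submodules.
Variables (R : pzRingType) (M : lmodType R).

Definition submod (S : submodClosed M) : Type := {x : M | x \in S}.

HB.instance Definition _ (S : submodClosed M) := SubChoice.on (submod S).
HB.instance Definition _ (S : submodClosed M) :=
  GRing.SubChoice_isSubLmodule.Build R M (fun x => x \in S) (submod S)
    (submodClosedP S).

Definition submod_incl (S : submodClosed M) : {linear submod S -> M} :=
  (\val : submod S -> M).

Definition in_top (x : M) : bool := true.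
Lemma in_top_closed : submod_closed in_top. Proof. by []. Qed.
HB.instance Definition _ := GRing.isSubmodClosed.Build R M in_top in_top_closed.
Definition top_submod : submodClosed M :=
  GRing.SubmodClosed.clone R M in_top _.

Definition fin_gen (S : submodClosed M) : Prop :=
  exists (n : nat) (g : 'I_n -> M),
    forall x, x \in S <-> exists c : 'I_n -> R, x = \sum_(i < n) c i *: g i.

End Submodules.

Arguments top_submod {R} M.

Definition fin_gen_mod (R : pzRingType) (M : lmodType R) : Prop :=
  fin_gen (top_submod M).

Section ImagePreimage.
Variables (R : pzRingType) (M N : lmodType R) (f : {linear M -> N}).

Definition in_im (y : N) : bool := `[< exists x, f x = y >].
Lemma in_im_closed : submod_closed in_im.
Proof.
split; first by apply/asboolP; exists 0; rewrite linear0.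
move=> a u v /asboolP[x <-] /asboolP[y <-].
by apply/asboolP; exists (a *: x + y); rewrite linearP.
Qed.
HB.instance Definition _ := GRing.isSubmodClosed.Build R N in_im in_im_closed.
Definition im_submod : submodClosed N :=
  GRing.SubmodClosed.clone R N in_im _.

Definition in_preim (S : submodClosed N) (x : M) : bool := f x \in S.
Lemma in_preim_closed S : submod_closed (in_preim S).
Proof.
split; first by rewrite /in_preim unfold_in linear0 rpred0.
by move=> a u v Su Sv; rewrite unfold_in /in_preim linearP rpredD ?rpredZ.
Qed.
HB.instance Definition _ (S : submodClosed N) :=
  GRing.isSubmodClosed.Build R M (in_preim S) (in_preim_closed S).
Definition preim_submod (S : submodClosed N) : submodClosed M :=
  GRing.SubmodClosed.clone R M (in_preim S) _.

End ImagePreimage.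

(* S seen as a submodule of the module T; meant for S contained in T. *)
Definition restr_submod (R : pzRingType) (M : lmodType R)
    (S T : submodClosed M) : submodClosed (submod T) :=
  preim_submod (submod_incl T) S.

Section DirectSums.
Variable R : pzRingType.

Definition in_prod (M N : lmodType R) (S : submodClosed M) (T : submodClosed N)
  (u : M * N) : bool := (u.1 \in S) && (u.2 \in T).
Lemma in_prod_closed M N S T : submod_closed (@in_prod M N S T).
Proof.
split; first by rewrite unfold_in /in_prod !rpred0.
move=> a u v /andP[Su Tu] /andP[Sv Tv].
by rewrite unfold_in /in_prod !rpredD ?rpredZ.
Qed.
HB.instance Definition _ (M N : lmodType R) (S : submodClosed M)
    (T : submodClosed N) :=
  GRing.isSubmodClosed.Build R (M * N)%type (@in_prod M N S T)
    (in_prod_closed S T).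
Definition prod_submod (M N : lmodType R) (S : submodClosed M)
  (T : submodClosed N) : submodClosed (M * N)%type :=
  GRing.SubmodClosed.clone R (M * N)%type (in_prod S T) _.

Definition prod_fun (M N M' N' : lmodType R)
  (f : {linear M -> N}) (g : {linear M' -> N'}) (u : M * M') : N * N' :=
  (f u.1, g u.2).
Lemma prod_fun_linear M N M' N' f g : linear (@prod_fun M N M' N' f g).
Proof. by move=> a u v; rewrite /prod_fun !linearP. Qed.
HB.instance Definition _ (M N M' N' : lmodType R)
    (f : {linear M -> N}) (g : {linear M' -> N'}) :=
  GRing.isLinear.Build R (M * M')%type (N * N')%type _ (@prod_fun M N M' N' f g)
    (prod_fun_linear f g).
Definition prod_map (M N M' N' : lmodType R)
  (f : {linear M -> N}) (g : {linear M' -> N'}) :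
  {linear (M * M')%type -> (N * N')%type} := prod_fun f g.

End DirectSums.

Section Quotients.
Variables (R : pzRingType) (M : lmodType R) (S : submodClosed M).

(* [Quotient.quot] expects a [zmodClosed] predicate. *)
Definition zmod_pred (x : M) : bool := x \in S.
Lemma zmod_pred_closed : zmod_closed zmod_pred.
Proof. exact: (submodClosedP S : zmod_closed _). Qed.
HB.instance Definition _ := GRing.isZmodClosed.Build M zmod_pred zmod_pred_closed.
Definition zmod_of_submod : zmodClosed M :=
  GRing.ZmodClosed.clone M zmod_pred _.

Definition quotmod : Type := Quotient.quot zmod_of_submod.
HB.instance Definition _ := GRing.Zmodule.on quotmod.
HB.instance Definition _ := EqQuotient.on quotmod.

Local Open Scope quotient_scope.

Definition quot_scale (a : R) (u : quotmod) : quotmod := \pi_quotmod (a *: repr u).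

Lemma quot_eqP (x y : M) :
  reflect (\pi_quotmod x = \pi_quotmod y) (x - y \in S).
Proof.
rewrite -[x - y \in S]/(x - y \in zmod_of_submod).
by rewrite Quotient.idealrBE; apply: eqP.
Qed.

Lemma pi_quotD (x y : M) :
  \pi_quotmod (x + y) = \pi_quotmod x + \pi_quotmod y.
Proof. exact: (Quotient.pi_add zmod_of_submod). Qed.

Lemma pi_quotZ (a : R) (x : M) :
  \pi_quotmod (a *: x) = quot_scale a (\pi_quotmod x).
Proof.
apply/quot_eqP; rewrite -scalerBr rpredZ //.
by apply/quot_eqP; rewrite reprK.
Qed.

Lemma pi_quot_surj (u : quotmod) : exists x, u = \pi_quotmod x.
Proof. by exists (repr u); rewrite reprK. Qed.

Lemma quot_scaleA a b u : quot_scale a (quot_scale b u) = quot_scale (a * b) u.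
Proof. by have [x ->] := pi_quot_surj u; rewrite -!pi_quotZ scalerA. Qed.
Lemma quot_scale1 : left_id 1 quot_scale.
Proof. by move=> u; have [x ->] := pi_quot_surj u; rewrite -pi_quotZ scale1r. Qed.
Lemma quot_scaleDr : right_distributive quot_scale +%R.
Proof.
move=> a u v; have [x ->] := pi_quot_surj u; have [y ->] := pi_quot_surj v.
by rewrite -pi_quotD -!pi_quotZ -pi_quotD scalerDr.
Qed.
Lemma quot_scaleDl u : {morph quot_scale^~ u : a b / a + b}.
Proof.
move=> a b; have [x ->] := pi_quot_surj u.
by rewrite -!pi_quotZ -pi_quotD scalerDl.
Qed.

HB.instance Definition _ := GRing.Zmodule_isLmodule.Build R quotmod
  quot_scaleA quot_scale1 quot_scaleDr quot_scaleDl.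

End Quotients.

Definition coker (R : pzRingType) (M N : lmodType R) (f : {linear M -> N}) :
  lmodType R := quotmod (im_submod f).

Section DirectLimits.

Record directed (J : Type) (le : J -> J -> Prop) : Prop := Directed {
  directed_inhabited : exists j : J, True;
  directed_refl : forall j, le j j;
  directed_trans : forall i j k, le i j -> le j k -> le i k;
  directed_bound : forall i j, exists k, le i k /\ le j k }.

(* The filter along which a net indexed by J converges. *)
Definition tails (J : Type) (le : J -> J -> Prop) : set_system J :=
  [set A | exists j, forall k, le j k -> A k].

Record direct_system (R : pzRingType) (J : Type) (le : J -> J -> Prop) :=
  DirectSystem {
    ds_obj :> J -> lmodType R;
    ds_map : forall j k, le j k -> {linear ds_obj j -> ds_obj k};
    ds_id : forall j (h : le j j), ds_map h =1 id;
    ds_comp : forall i j k (hij : le i j) (hjk : le j k) (hik : le i k),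
      ds_map hjk \o ds_map hij =1 ds_map hik }.

Section Limit.
Variables (R : pzRingType) (J : Type) (le : J -> J -> Prop).
Variable M : direct_system R le.

Definition cocone (N : lmodType R) (f : forall j, {linear M j -> N}) : Prop :=
  forall j k (h : le j k), f k \o ds_map M h =1 f j.

Definition is_direct_limit (L : lmodType R) (b : forall j, {linear M j -> L}) :
    Prop :=
  cocone b /\
  forall (N : lmodType R) (f : forall j, {linear M j -> N}), cocone f ->
    exists2 g : {linear L -> N}, (forall j, g \o b j =1 f j)
      & forall g' : {linear L -> N}, (forall j, g' \o b j =1 f j) -> g' =1 g.

End Limit.
End DirectLimits.

Section RankFunctions.
Variables (R : pzRingType) (K : realType).
Local Open Scope ereal_scope.

(* [d M2 M1] stands for dim(M1|M2). *)
Definition bivariant_fun : Type :=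
  forall M : lmodType R, submodClosed M -> \bar K.

Definition map_fun : Type :=
  forall M N : lmodType R, {linear M -> N} -> \bar K.

Definition total_dim (d : bivariant_fun) (M : lmodType R) : \bar K :=
  d M (top_submod M).

Record bivariant_rank (d : bivariant_fun) : Prop := BivariantRank {
  biv_ge0 : forall (M : lmodType R) (S : submodClosed M), 0 <= d M S;
  biv_iso : forall (M N : lmodType R) (S : submodClosed M) (T : submodClosed N)
    (f : {linear M -> N}), bijective f ->
    (forall x, (f x \in T) = (x \in S)) -> d M S = d N T;
  biv_zero : forall M : lmodType R, (forall x : M, x = 0%R) ->
    total_dim d M = 0;
  biv_one : total_dim d R^o = 1;
  biv_sum : forall (M N : lmodType R) (S : submodClosed M) (T : submodClosed N),
    d (M * N)%type (prod_submod S T) = d M S + d N T;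
  biv_sup : forall (M : lmodType R) (S : submodClosed M),
    d M S = ereal_sup [set d M S' | S' in
              [set S' : submodClosed M | fin_gen S' /\ {subset S' <= S}]];
  biv_inf : forall (M : lmodType R) (S : submodClosed M), fin_gen S ->
    d M S = ereal_inf [set d (submod T) (restr_submod S T) | T in
              [set T : submodClosed M | fin_gen T /\ {subset S <= T}]];
  biv_quot : forall (M : lmodType R) (S : submodClosed M),
    total_dim d M = d M S + total_dim d (quotmod S) }.

(* Maps are composed as functions: the paper's product "first a, then b" is
   [b \o a]. *)
Record extended_map_rank (rk : map_fun) : Prop := ExtendedMapRank {
  emr_ge0 : forall (M N : lmodType R) (f : {linear M -> N}), 0 <= rk M N f;
  emr_zero : forall M N : lmodType R, rk M N \0%R = 0;
  emr_one : rk R^o R^o idfun = 1;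
  emr_comp : forall (M N P : lmodType R) (a : {linear M -> N})
    (b : {linear N -> P}), rk M P (b \o a) <= Order.min (rk M N a) (rk N P b);
  emr_sum : forall (M N M' N' : lmodType R) (a : {linear M -> N})
    (b : {linear M' -> N'}), rk _ _ (prod_map a b) = rk M N a + rk M' N' b;
  emr_lim_dom : forall (J : Type) (le : J -> J -> Prop), directed le ->
    forall (D : direct_system R le) (L : lmodType R)
      (b : forall j, {linear D j -> L}), is_direct_limit b ->
    forall (N : lmodType R) (a : forall j, {linear D j -> N})
      (a_lim : {linear L -> N}),
    (forall j k (h : le j k), a k \o ds_map D h =1 a j) ->
    (forall j, a_lim \o b j =1 a j) ->
    rk _ _ (a j) @[j --> tails le] --> rk _ _ a_lim;
  emr_lim_cod : forall (J : Type) (le : J -> J -> Prop), directed le ->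
    forall (D : direct_system R le) (L : lmodType R)
      (b : forall j, {linear D j -> L}), is_direct_limit b ->
    forall (M : lmodType R) (a : forall j, {linear M -> D j})
      (a_lim : {linear M -> L}), fin_gen_mod M ->
    (forall j k (h : le j k), ds_map D h \o a j =1 a k) ->
    (forall j, b j \o a j =1 a_lim) ->
    rk _ _ (a j) @[j --> tails le] --> rk _ _ a_lim;
  emr_coker : forall (M N : lmodType R) (a : {linear M -> N}),
    rk N N idfun = rk M N a + rk (coker a) (coker a) idfun }.

Definition dim_of_rk (rk : map_fun) : bivariant_fun :=
  fun M S => rk (submod S) M (submod_incl S).

Definition rk_of_dim (d : bivariant_fun) : map_fun :=
  fun M N a => d N (im_submod a).

End RankFunctions.

(* Main.v *)
(** For a rank function on maps, [rk a] and [rk (im a -> N)] agree when N is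
    finitely generated, because then rk(id_N) is finite and both equal
    rk(id_N) - rk(id_coker); the continuity axioms (4) and (5) of [rk], applied
    to N and the source as directed unions of finitely generated submodules, give
    the general case.

    For a bivariant dimension the key inequality is dim(bA|P) <= dim(A|N) for
    b : N -> P and A contained in N. Axioms (4) and (5) reduce it to N and P
    finitely generated, where all dimensions are finite; additivity turns it into
    dim(P) + dim(N/A) <= dim(N) + dim(P/bA), and N -> P (+) N/A has cokernel
    P/bA. *)

Require Import Defs.
From HB Require Import structures.
From mathcomp Require Import all_boot all_order all_algebra.
From mathcomp Require Import all_classical all_reals all_analysis.
From mathcomp Require Import generic_quotient ring_quotient.

Set Implicit Arguments.
Unset Strict Implicit.
Unset Printing Implicit Defensive.

Import Order.TTheory GRing.Theory Num.Theory.
Import numFieldNormedType.Exports.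

Local Open Scope classical_set_scope.
Local Open Scope ring_scope.

(** * Modules, submodules and quotients *)

(** A dimension is a function of the packed submodule, so submodules with the same members must
    become equal before their dimensions can be compared. All fields but the predicate are proofs,
    identified by proof irrelevance. *)
Lemma submod_ext (R : pzRingType) (M : lmodType R) (S T : submodClosed M) :
  S =i T -> S = T.
Proof.
case: S T => [s [[a] [b]]] [t [[a'] [b']]] eq_st.
have E : s = t by apply/funext => x; exact: eq_st x.
case: _ / E in a' b' eq_st *.
by rewrite (Prop_irrelevance a a') (Prop_irrelevance b b').
Qed.

Lemma linear_ext (R : pzRingType) (M N : lmodType R) (f g : {linear M -> N}) :
  f =1 g -> f = g.
Proof.
case: f g => [f [[a] [b]]] [g [[a'] [b']]] eq_fg.
have E : f = g by apply/funext => x; exact: eq_fg x.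
case: _ / E in a' b' eq_fg *.
by rewrite (Prop_irrelevance a a') (Prop_irrelevance b b').
Qed.

Lemma bijective_inj_surj (A B : Type) (f : A -> B) :
  injective f -> (forall y, exists x, f x = y) -> bijective f.
Proof.
move=> finj /choice[g gK]; exists g => // x.
by apply: finj; rewrite gK.
Qed.

Section Modules.
Variable R : pzRingType.
Implicit Types M N P : lmodType R.

Definition mk_linear M N (f : M -> N) (fP : linear f) : {linear M -> N} :=
  HB.pack_for {linear M -> N} f (GRing.isLinear.Build R M N _ f fP).

Definition mk_submod M (p : M -> bool) (pP : submod_closed p) : submodClosed M :=
  HB.pack_for (submodClosed M) (p : {pred M})
    (GRing.isSubmodClosed.Build R M (p : {pred M}) pP).

Lemma mem_imP M N (f : {linear M -> N}) y :
  reflect (exists x, f x = y) (y \in im_submod f).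
Proof. exact: asboolP. Qed.

Lemma mem_im M N (f : {linear M -> N}) x : f x \in im_submod f.
Proof. by apply/mem_imP; exists x. Qed.

Lemma mem_preim M N (f : {linear M -> N}) S x :
  (x \in preim_submod f S) = (f x \in S).
Proof. by []. Qed.

Lemma mem_restr M (S T : submodClosed M) (x : submod T) :
  (x \in restr_submod S T) = (val x \in S).
Proof. by []. Qed.

Lemma mem_prod M N (S : submodClosed M) (T : submodClosed N) u :
  (u \in prod_submod S T) = (u.1 \in S) && (u.2 \in T).
Proof. by []. Qed.

Lemma mem_top M (x : M) : x \in top_submod M. Proof. by []. Qed.

Section Kernel.
Variables (M N : lmodType R) (f : {linear M -> N}).
Definition in_ker (x : M) : bool := `[< f x = 0 >].
Lemma in_ker_closed : submod_closed in_ker.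
Proof.
split; first by apply/asboolP; rewrite linear0.
move=> a u v /asboolP fu /asboolP fv.
by apply/asboolP; rewrite linearP fu fv scaler0 addr0.
Qed.
Definition ker_submod : submodClosed M := mk_submod in_ker_closed.
Lemma mem_kerP x : reflect (f x = 0) (x \in ker_submod).
Proof. exact: asboolP. Qed.
End Kernel.

Section Corestriction.
Variables (M N : lmodType R) (f : {linear M -> N}) (T : submodClosed N).
Hypothesis fT : forall x, f x \in T.
Definition corestr_fun (x : M) : submod T := Sub (f x) (fT x).
Lemma corestr_linear : linear corestr_fun.
Proof. by move=> a u v; apply: val_inj; rewrite /= linearP. Qed.
Definition corestr : {linear M -> submod T} := mk_linear corestr_linear.
End Corestriction.

Definition submod_widen M (S T : submodClosed M) (ST : {subset S <= T}) :
  {linear submod S -> submod T} :=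
  corestr (f := submod_incl S) (fun x => ST _ (valP x)).

(** * Spans and finitely generated submodules *)

Section Span.
Variables (M : lmodType R) (n : nat) (g : 'I_n -> M).
Definition comb (c : 'I_n -> R) : M := \sum_(i < n) c i *: g i.
Definition in_span (x : M) : bool := `[< exists c, x = comb c >].
Lemma in_span_closed : submod_closed in_span.
Proof.
split.
  by apply/asboolP; exists (fun=> 0); rewrite /comb big1 // => i _; rewrite scale0r.
move=> a u v /asboolP[c ->] /asboolP[c' ->]; apply/asboolP.
exists (fun i => a * c i + c' i); rewrite /comb scaler_sumr -big_split /=.
by apply: eq_bigr => i _; rewrite scalerA scalerDl.
Qed.
Definition span_submod : submodClosed M := mk_submod in_span_closed.
Lemma mem_spanP x : reflect (exists c, x = comb c) (x \in span_submod).
Proof. exact: asboolP. Qed.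

Lemma mem_span i : g i \in span_submod.
Proof.
apply/mem_spanP; exists (fun j => (j == i)%:R).
rewrite /comb (bigD1 i) //= eqxx scale1r big1 ?addr0 // => j /negPf ->.
by rewrite scale0r.
Qed.

Lemma span_subset (S : submodClosed M) :
  (forall i, g i \in S) -> {subset span_submod <= S}.
Proof.
move=> gS x /mem_spanP[c ->]; apply: rpred_sum => i _; exact: rpredZ.
Qed.

Lemma fin_gen_span : fin_gen span_submod.
Proof. by exists n, g => x; split=> /mem_spanP. Qed.
End Span.

Lemma fin_genP M (S : submodClosed M) :
  fin_gen S -> exists n (g : 'I_n -> M), S = span_submod g.
Proof.
case=> n [g gP]; exists n, g; apply: submod_ext => x.
by apply/idP/idP => [/gP/mem_spanP|/mem_spanP/gP].
Qed.

(** The working form of finite generation: an inclusion out of [S] is checked on generators, and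
    finitely many of these are served by one index of a directed set. *)
Lemma fin_gen_gens M (S : submodClosed M) :
  fin_gen S -> exists n (g : 'I_n -> M), (forall i, g i \in S) /\
    (forall T : submodClosed M, (forall i, g i \in T) -> {subset S <= T}).
Proof.
move=> /fin_genP[n [g ->]]; exists n, g; split; first exact: mem_span.
exact: span_subset.
Qed.

(** [A'] is spanned by chosen lifts of the generators of [S], so it maps onto exactly [S]. *)
Lemma fin_gen_lift M N (f : {linear M -> N}) (A : submodClosed M)
    (S : submodClosed N) : fin_gen S ->
  (forall y, y \in S -> exists2 x, x \in A & f x = y) ->
  exists A' : submodClosed M, [/\ fin_gen A', {subset A' <= A},
    (forall y, y \in S -> exists2 x, x \in A' & f x = y) &
    (forall x, x \in A' -> f x \in S)].
Proof.
move=> /fin_genP[n [g ->]] lift.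
have /choice[h hP] : forall i, exists x, x \in A /\ f x = g i.
  by move=> i; have [x xA fx] := lift _ (mem_span g i); exists x.
have fh c : f (comb h c) = comb g c.
  rewrite /comb linear_sum; apply: eq_bigr => i _.
  by rewrite linearZ /= (hP i).2.
exists (span_submod h); split; first exact: fin_gen_span.
- by apply: span_subset => i; case: (hP i).
- move=> y /mem_spanP[c ->]; exists (comb h c); last exact: fh.
  by apply/mem_spanP; exists c.
- by move=> x /mem_spanP[c ->]; rewrite fh; apply/mem_spanP; exists c.
Qed.

Lemma fin_gen_im M N (f : {linear M -> N}) (A : submodClosed M)
    (S : submodClosed N) : fin_gen A ->
  (forall y, y \in S -> exists2 x, x \in A & f x = y) ->
  (forall x, x \in A -> f x \in S) -> fin_gen S.
Proof.
move=> [n [g gP]] lift fAS; exists n, (f \o g) => y.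
have fg c : f (comb g c) = comb (f \o g) c.
  by rewrite /comb linear_sum; apply: eq_bigr => i _; rewrite linearZ.
split=> [/lift[x /gP[c ->] <-]|[c ->]]; first by exists c; exact: fg.
by rewrite -[X in X \in _](fg c) fAS //; apply/gP; exists c.
Qed.

(** From left to right, lifting generators along the injective inclusion yields a submodule that
    must be all of [submod S]. *)
Lemma fin_gen_submod M (S : submodClosed M) : fin_gen S <-> fin_gen_mod (submod S).
Proof.
split=> Sfg; last first.
  apply: (fin_gen_im (f := submod_incl S) Sfg) => [y yS|x _]; last exact: valP.
  by exists (Sub y yS).
have [|A [Afg _ lift _]] := fin_gen_lift (f := submod_incl S)
  (A := top_submod (submod S)) Sfg.
  by move=> y yS; exists (Sub y yS).
suff E : top_submod (submod S) = A by rewrite /fin_gen_mod E.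
apply: submod_ext => x; rewrite mem_top; apply/esym.
by have [z zA /val_inj <-] := lift _ (valP x).
Qed.

(** * Quotient modules and maps out of them *)

Section Quotient.
Variables (M : lmodType R) (S : submodClosed M).
Local Open Scope quotient_scope.

Definition quot_pi_fun (x : M) : quotmod S := \pi_(quotmod S) x.
Lemma quot_pi_linear : linear quot_pi_fun.
Proof. by move=> a u v; rewrite /quot_pi_fun pi_quotD pi_quotZ. Qed.
Definition quot_pi : {linear M -> quotmod S} := mk_linear quot_pi_linear.

Lemma quot_pi_surj u : exists x, quot_pi x = u.
Proof. by have [x ->] := pi_quot_surj u; exists x. Qed.

Lemma quot_piP x y : reflect (quot_pi x = quot_pi y) (x - y \in S).
Proof. exact: quot_eqP. Qed.

Lemma quot_pi_eq0 x : quot_pi x = 0 <-> x \in S.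
Proof.
rewrite -[x in x \in S]subr0 -[0 in X in X <-> _](linear0 quot_pi).
by split=> /quot_piP.
Qed.

Variables (N : lmodType R) (f : {linear M -> N}).
Hypothesis fS : forall x, x \in S -> f x = 0.
Definition quot_lift_fun (u : quotmod S) : N := f (repr u).
Lemma quot_lift_funE x : quot_lift_fun (quot_pi x) = f x.
Proof.
apply/eqP; rewrite -subr_eq0 -linearB; apply/eqP/fS/quot_piP.
exact: reprK.
Qed.
Lemma quot_lift_linear : linear quot_lift_fun.
Proof.
move=> a u v; have [x <-] := quot_pi_surj u; have [y <-] := quot_pi_surj v.
by rewrite -linearP !quot_lift_funE linearP.
Qed.
Definition quot_lift : {linear quotmod S -> N} := mk_linear quot_lift_linear.
Lemma quot_liftE x : quot_lift (quot_pi x) = f x.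
Proof. exact: quot_lift_funE. Qed.
End Quotient.

End Modules.

(** * Direct limits *)

Section ProductModule.
Variables (R : pzRingType) (J : Type) (D : J -> lmodType R).

(** The product of all [D j]. Modulo tail-null families it receives a cocone that tells which
    elements die in the limit, so no concrete limit has to be built. *)
Definition family : Type := forall j, D j.
HB.instance Definition _ := gen_eqMixin family.
HB.instance Definition _ := gen_choiceMixin family.

Let fadd (u v : family) : family := fun j => u j + v j.
Let fopp (u : family) : family := fun j => - u j.
Let fzero : family := fun=> 0.
Let fscale (a : R) (u : family) : family := fun j => a *: u j.

Fact faddA : associative fadd.
Proof. by move=> u v w; apply: functional_extensionality_dep => j; exact: addrA. Qed.
Fact faddC : commutative fadd.
Proof. by move=> u v; apply: functional_extensionality_dep => j; exact: addrC. Qed.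
Fact fadd0 : left_id fzero fadd.
Proof. by move=> u; apply: functional_extensionality_dep => j; exact: add0r. Qed.
Fact faddN : left_inverse fzero fopp fadd.
Proof. by move=> u; apply: functional_extensionality_dep => j; exact: addNr. Qed.
HB.instance Definition _ := GRing.isZmodule.Build family faddA faddC fadd0 faddN.

Fact fscaleA a b u : fscale a (fscale b u) = fscale (a * b) u.
Proof. by apply: functional_extensionality_dep => j; exact: scalerA. Qed.
Fact fscale1 : left_id 1 fscale.
Proof. by move=> u; apply: functional_extensionality_dep => j; exact: scale1r. Qed.
Fact fscaleDr : right_distributive fscale +%R.
Proof. by move=> a u v; apply: functional_extensionality_dep => j; exact: scalerDr. Qed.
Fact fscaleDl u : {morph fscale^~ u : a b / a + b}.
Proof. by move=> a b; apply: functional_extensionality_dep => j; exact: scalerDl. Qed.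
HB.instance Definition _ := GRing.Zmodule_isLmodule.Build R family
  fscaleA fscale1 fscaleDr fscaleDl.

Lemma familyD (u v : family) j : (u + v) j = u j + v j. Proof. by []. Qed.
Lemma familyZ a (u : family) j : (a *: u) j = a *: u j. Proof. by []. Qed.
Lemma familyB (u v : family) j : (u - v) j = u j - v j. Proof. by []. Qed.
End ProductModule.

Lemma tails_proper (J : Type) (le : J -> J -> Prop) :
  directed le -> ProperFilter (tails le).
Proof.
move=> [[j0 _] lexx let_ leb]; apply: Build_ProperFilter_ex.
  by move=> P [j jP]; exists j; exact: jP.
split; first by exists j0.
  move=> P Q [i iP] [j jQ]; have [k [ik jk]] := leb i j; exists k => l kl.
  by split; [apply: iP; apply: let_ ik kl|apply: jQ; apply: let_ jk kl].
by move=> P Q PQ [j jP]; exists j => k /jP /PQ.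
Qed.

Lemma directed_bound_fin (J : Type) (le : J -> J -> Prop) (n : nat)
    (f : 'I_n -> J) : directed le -> exists k, forall i, le (f i) k.
Proof.
move=> [[j0 _] lexx let_ leb].
elim: n f => [|n IH] f; first by exists j0 => -[].
have [k kP] := IH (f \o lift ord0); have [l [kl fl]] := leb k (f ord0).
exists l => i; case: (unliftP ord0 i) => [i' ->|-> //].
by apply: let_ kl; exact: kP.
Qed.

Section DirectLimitTheory.
Variables (R : pzRingType) (J : Type) (le : J -> J -> Prop).
Hypothesis dir : directed le.
Variables (D : direct_system R le) (L : lmodType R).
Variable b : forall j, {linear D j -> L}.

Lemma ds_map_comp i j k (hij : le i j) (hjk : le j k) (hik : le i k) x :
  ds_map D hjk (ds_map D hij x) = ds_map D hik x.
Proof. exact: ds_comp. Qed.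

Lemma cocone_map (N : lmodType R) (f : forall j, {linear D j -> N}) :
  cocone f -> forall j k (h : le j k) x, f k (ds_map D h x) = f j x.
Proof. by move=> fP j k h; exact: fP. Qed.

(** An element of [L] goes to the value of [f] on any representative. Two representatives agree at a
    common later index because the [b j] are injective, so the value is well defined. *)
Lemma direct_union_is_limit : cocone b ->
  (forall y, exists j x, b j x = y) -> (forall j, injective (b j)) ->
  is_direct_limit b.
Proof.
move=> bP bsurj binj; split=> // N f fP.
have /choice[s sP] : forall y, exists z : N, forall j x, b j x = y -> f j x = z.
  move=> y; have [i [x xy]] := bsurj y; exists (f i x) => j x' x'y.
  have [k [ik jk]] := directed_bound dir i j.
  rewrite -(cocone_map fP ik) -(cocone_map fP jk); congr (f k _).
  by apply: binj; rewrite !cocone_map // xy.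
have s_lin : linear s.
  move=> a u v; have [i [x xu]] := bsurj u; have [j [y yv]] := bsurj v.
  have [k [ik jk]] := directed_bound dir i j.
  rewrite -(sP u i x xu) -(sP v j y yv) -(cocone_map fP ik) -(cocone_map fP jk).
  rewrite -linearP; apply/esym/sP.
  by rewrite linearP !cocone_map // xu yv.
exists (mk_linear s_lin) => [j x|g gP y]; first by apply/esym/(sP _ j).
have [j [x xy]] := bsurj y; rewrite -xy -[LHS]/((g \o b j) x) gP.
exact: sP.
Qed.

Hypothesis bP : is_direct_limit b.

Definition in_union (y : L) : bool := `[< exists j x, b j x = y >].
Lemma in_union_closed : submod_closed in_union.
Proof.
split.
  by have [j _] := directed_inhabited dir; apply/asboolP; exists j, 0; rewrite linear0.
move=> a u v /asboolP[i [x <-]] /asboolP[j [y <-]]; apply/asboolP.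
have [k [ik jk]] := directed_bound dir i j.
exists k, (a *: ds_map D ik x + ds_map D jk y).
by rewrite linearP !cocone_map //; case: bP.
Qed.

(* The quotient map of L by the union of the images and the zero map both
   factor the zero cocone. *)
Lemma direct_limit_surj y : exists j x, b j x = y.
Proof.
set U := mk_submod in_union_closed.
pose z j : {linear D j -> quotmod U} := \0%R.
have zP : cocone z by [].
have [g _ g_uniq] := bP.2 _ z zP.
have pi0 : quot_pi U =1 g.
  apply: g_uniq => j x /=; apply/quot_pi_eq0.
  by apply/asboolP; exists j, x.
have zg : (\0%R : {linear L -> quotmod U}) =1 g by apply: g_uniq.
suff : y \in U by move/asboolP.
by apply/quot_pi_eq0; rewrite pi0 -zg.
Qed.

Definition tail_null (u : family D) : bool :=
  `[< exists j, forall k, le j k -> u k = 0 >].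
Lemma tail_null_closed : submod_closed tail_null.
Proof.
split.
  by have [j _] := directed_inhabited dir; apply/asboolP; exists j.
move=> a u v /asboolP[i iP] /asboolP[j jP]; apply/asboolP.
have [k [ik jk]] := directed_bound dir i j.
exists k => l kl; rewrite familyD familyZ iP ?jP ?scaler0 ?addr0 //.
  exact: (directed_trans dir jk kl).
exact: (directed_trans dir ik kl).
Qed.

(** The 0 at indices not above [j] is a default value that disappears modulo tail-null families. *)
Definition orbit_fun j (x : D j) : family D :=
  fun k => if pselect (le j k) is left h then ds_map D h x else 0.
Lemma orbit_linear j : linear (@orbit_fun j).
Proof.
move=> a u v; apply: functional_extensionality_dep => k.
rewrite familyD familyZ /orbit_fun; case: pselect => h; first exact: linearP.
by rewrite scaler0 addr0.
Qed.

(* The cocone into families modulo tail-null families detects the elements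
   that die at some stage of the system. *)
Lemma direct_limit_ker j (x : D j) :
  b j x = 0 -> exists k (h : le j k), ds_map D h x = 0.
Proof.
move=> bx0; set U := mk_submod tail_null_closed.
pose f i : {linear D i -> quotmod U} := quot_pi U \o mk_linear (@orbit_linear i).
have fP : cocone f.
  move=> i k h y /=; apply/quot_piP/asboolP; exists k => l kl.
  rewrite familyB /= /orbit_fun; case: pselect => // kl'.
  case: pselect => [il|]; first by rewrite (ds_map_comp _ _ il) subrr.
  by case; exact: (directed_trans dir h kl).
have [g gP _] := bP.2 _ f fP.
have : f j x = 0 by rewrite -gP /= bx0 linear0.
move/quot_pi_eq0/asboolP => [i iP].
have [k [ik jk]] := directed_bound dir i j.
exists k, jk; have := iP k ik; rewrite /= /orbit_fun.
by case: pselect => // h; rewrite (Prop_irrelevance h jk).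
Qed.
End DirectLimitTheory.

(** * Bivariant dimensions *)

(** Nonnegativity excludes the limit [-oo]. Around a finite limit the two bounds trap the net in an
    interval; at [+oo] the lower bounds suffice. *)
Lemma cvg_tails_ge0 (K : realType) (J : Type) (le : J -> J -> Prop)
    (f : J -> \bar K) (l : \bar K) : (0 <= l)%E -> directed le ->
  (forall c, (c < l)%E -> exists j, forall k, le j k -> (c < f k)%E) ->
  (forall c, (l < c)%E -> exists j, forall k, le j k -> (f k < c)%E) ->
  f j @[j --> tails le] --> l.
Proof.
move=> l0 dir lo hi; case: l l0 lo hi => [r||] // l0 lo hi A.
  move=> [e /= e0 eA].
  have [|j jP] := lo (r - e)%:E; first by rewrite lte_fin gtrBl.
  have [|j' j'P] := hi (r + e)%:E; first by rewrite lte_fin ltrDl.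
  have [k [jk j'k]] := directed_bound dir j j'; exists k => i ki.
  have := jP i (directed_trans dir jk ki).
  have := j'P i (directed_trans dir j'k ki).
  rewrite /preimage /=; case: (f i) => [s||] //; rewrite !lte_fin => h1 h2.
  by apply: (eA s); rewrite /ball_ /= distrC ltr_distl h1 h2.
move=> [M [_ MA]]; have [|j jP] := lo M%:E; first by rewrite ltry.
by exists j => k /jP; exact: MA.
Qed.

Section BivariantTheory.
Variables (R : pzRingType) (K : realType) (d : bivariant_fun R K).
Hypothesis dP : bivariant_rank d.
Implicit Types M N P : lmodType R.
Local Open Scope ereal_scope.

Let tot M := total_dim d M.

Lemma total_ge0 M : 0 <= tot M. Proof. exact: biv_ge0 dP _ _. Qed.

Lemma total_iso M N (f : {linear M -> N}) : bijective f -> tot M = tot N.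
Proof. by move=> fbij; apply: (biv_iso dP fbij). Qed.

(** By the first isomorphism theorem, [quot_lift] is bijective. *)
Lemma total_quotE M N (S : submodClosed M) (f : {linear M -> N}) :
  (forall y, exists x, f x = y) -> (forall x, x \in S <-> f x = 0%R) ->
  tot (quotmod S) = tot N.
Proof.
move=> fsurj fS.
have fS0 x : x \in S -> f x = 0%R by move/fS.
apply: (total_iso (f := quot_lift fS0)); apply: bijective_inj_surj => [u v|y].
  have [x <-] := quot_pi_surj u; have [x' <-] := quot_pi_surj v.
  rewrite !quot_liftE => e; apply/quot_piP/fS.
  by rewrite linearB e subrr.
by have [x <-] := fsurj y; exists (quot_pi S x); rewrite quot_liftE.
Qed.

Lemma total_surj M N (f : {linear M -> N}) : (forall y, exists x, f x = y) ->
  tot M = d (ker_submod f) + tot N.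
Proof.
move=> fsurj; rewrite -(total_quotE (S := ker_submod f) fsurj).
  exact: biv_quot dP _ _.
by move=> x; split => /mem_kerP.
Qed.

Lemma total_surj_le M N (f : {linear M -> N}) :
  (forall y, exists x, f x = y) -> tot N <= tot M.
Proof. by move=> /total_surj ->; rewrite leeDr// (biv_ge0 dP). Qed.

Lemma dim_le_restr M (S T : submodClosed M) : fin_gen S -> fin_gen T ->
  {subset S <= T} -> d S <= d (restr_submod S T).
Proof.
move=> Sfg Tfg ST; rewrite [leLHS](biv_inf dP)//.
by apply: ereal_inf_lbound; exists T.
Qed.

(** [S] itself is a competitor for the ambient module in [biv_inf]. *)
Lemma dim_fin_gen_le M (S : submodClosed M) : fin_gen S -> d S <= tot (submod S).
Proof.
move=> Sfg; apply: le_trans (dim_le_restr Sfg Sfg _) _ => //.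
rewrite (_ : restr_submod S S = top_submod _) //.
by apply: submod_ext => x; rewrite mem_restr (valP x) mem_top.
Qed.

(** By [biv_quot] only d(im f) <= tot M is at stake. The image is finitely generated, so its
    dimension in [N] is at most its total dimension, and it is a quotient of [M]. *)
Lemma total_coker_le M N (f : {linear M -> N}) : fin_gen_mod M ->
  tot N <= tot M + tot (coker f).
Proof.
move=> Mfg; rewrite [leLHS](biv_quot dP (im_submod f)) leeD2r //.
have imfg : fin_gen (im_submod f).
  by apply: (fin_gen_im (f := f) Mfg) => [y /mem_imP[x <-]|x _];
    [exists x|exact: mem_im].
apply: le_trans (dim_fin_gen_le imfg) _.
apply: (total_surj_le (f := corestr (mem_im f))) => -[y yP].
by have /mem_imP[x xy] := yP; exists x; apply: val_inj.
Qed.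

(** Induction on the number of generators: the first one gives a map from [R^o], of dimension 1,
    whose cokernel is generated by the others. *)
Lemma total_lty M : fin_gen_mod M -> tot M < +oo.
Proof.
case=> n [g gP].
have {}gP x : exists c, x = comb g c by apply/gP.
elim: n => [|n IH] in M g gP *.
  rewrite /tot (biv_zero dP) ?ltry// => x.
  by have [c ->] := gP x; rewrite /comb big_ord0.
have f_lin : linear (fun a : R^o => (a : R) *: g ord0)%R.
  by move=> a u v; rewrite scalerDl scalerA.
have Rfg : fin_gen_mod R^o.
  exists 1%N, (fun=> 1%R) => x; split=> // _; exists (fun=> x).
  by rewrite big_ord1; exact/esym/mulr1.
apply: le_lt_trans (total_coker_le (mk_linear f_lin) Rfg) _.
rewrite lte_add_pinfty //; first by rewrite /tot (biv_one dP) ltry.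
apply: (IH _ (fun i => quot_pi _ (g (lift ord0 i)))) => u.
have [x <-] := quot_pi_surj u; have [c ->] := gP x.
exists (fun i => c (lift ord0 i)); rewrite /comb big_ord_recl linearD.
rewrite (_ : quot_pi _ _ = 0%R); last first.
  by apply/quot_pi_eq0/mem_imP; exists (c ord0).
by rewrite add0r linear_sum; apply: eq_bigr => i _; rewrite linearZ.
Qed.

Lemma total_fin_num M : fin_gen_mod M -> tot M \is a fin_num.
Proof. by move=> /total_lty M_lty; rewrite ge0_fin_numE ?total_ge0. Qed.

Lemma total_prod M N : tot (M * N)%type = tot M + tot N.
Proof.
rewrite /tot /total_dim -(biv_sum dP); congr (d _).
exact: submod_ext.
Qed.

Lemma dim_le_total M (S : submodClosed M) : d S <= tot M.
Proof. by rewrite [leRHS](biv_quot dP S) leeDl // total_ge0. Qed.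

Lemma dim_fin_num M (S : submodClosed M) : tot M \is a fin_num ->
  d S \is a fin_num.
Proof.
rewrite ge0_fin_numE ?total_ge0// => M_fin.
by rewrite ge0_fin_numE ?(biv_ge0 dP)// (le_lt_trans (dim_le_total S)).
Qed.

Lemma total_quot_fin_num M (S : submodClosed M) : tot M \is a fin_num ->
  tot (quotmod S) \is a fin_num.
Proof. by rewrite [tot M](biv_quot dP S) fin_numD => /andP[]. Qed.

(* The map N -> P (+) N/A given by b and the projection has cokernel P/S. *)
Lemma dim_im_fin_gen_le N P (b : {linear N -> P}) (A : submodClosed N)
    (S : submodClosed P) : fin_gen_mod N -> fin_gen_mod P ->
  (forall y, y \in S -> exists2 x, x \in A & b x = y) ->
  (forall x, x \in A -> b x \in S) -> d S <= d A.
Proof.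
move=> Nfg Pfg lift bAS.
have f_lin : linear (fun x : N => (b x, quot_pi A x) : P * quotmod A).
  by move=> a u v; rewrite !linearP.
set f := mk_linear f_lin.
have h_lin : linear (fun p : P => quot_pi (im_submod f) (p, 0%R)).
  move=> a u v; rewrite -linearP; congr (quot_pi _ _).
  by apply/eqP; rewrite xpair_eqE /= scaler0 addr0 !eqxx.
have := total_coker_le f Nfg; rewrite total_prod.
rewrite -(total_quotE (S := S) (f := mk_linear h_lin)); last 2 first.
(* Every class has a representative in the first factor: subtracting [f x], with [x] a lift of [v],
   clears the second coordinate. *)
- move=> u; have [[p v] <-] := quot_pi_surj u; have [x <-] := quot_pi_surj v.
  exists (p - b x)%R; apply/quot_piP/mem_imP; exists (- x)%R.
  rewrite /= !linearN; apply/eqP; rewrite xpair_eqE /=.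
  rewrite addrAC subrr add0r sub0r.
  by rewrite [quot_pi_fun A _](linearN (quot_pi A)) !eqxx.
- move=> y; split=> [/lift[x xA <-]|/quot_pi_eq0/mem_imP[x [<- /quot_pi_eq0]]].
    apply/quot_pi_eq0/mem_imP; exists x => /=.
    by congr (_, _); apply/quot_pi_eq0.
  exact: bAS.
have Nfin := total_fin_num Nfg; have Pfin := total_fin_num Pfg.
(* After expansion both sides contain tot(P/S) + tot(N/A), which is finite and cancels. *)
rewrite [tot P](biv_quot dP S) [tot N](biv_quot dP A).
rewrite -addeA -addeA [X in _ <= _ + X]addeC leeD2rE //.
by rewrite fin_numD !total_quot_fin_num.
Qed.

Lemma dim_mono M (S T : submodClosed M) : {subset S <= T} -> d S <= d T.
Proof.
move=> ST; rewrite [leLHS](biv_sup dP) [leRHS](biv_sup dP).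
apply: ereal_sup_le => _ [S' [S'fg S'S] <-]; exists S' => //.
by split=> // x /S'S /ST.
Qed.

(** The hypothesis says that [S] lies in the image of [A]. With [b] an inclusion, this shows that
    enlarging the ambient module cannot raise a dimension. *)
Lemma dim_im_le N P (b : {linear N -> P}) (A : submodClosed N)
    (S : submodClosed P) :
  (forall y, y \in S -> exists2 x, x \in A & b x = y) -> d S <= d A.
Proof.
move=> lift; rewrite [leLHS](biv_sup dP).
apply: ge_ereal_sup => _ [S' [S'fg S'S] <-].
have [|A' [A'fg A'A liftA' bA'S']] := fin_gen_lift S'fg (f := b) (A := A).
  by move=> y /S'S /lift.
apply: le_trans (dim_mono A'A); rewrite [leRHS](biv_inf dP) //.
apply: le_ereal_inf_tmp => _ [T [Tfg A'T] <-].
(* The finitely generated case is applied to [T] and its image under [b], in place of [N] and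
   [P]. *)
pose c := b \o submod_incl T.
have Tfg' := (fin_gen_submod T).1 Tfg.
have imfg : fin_gen (im_submod c).
  by apply: (fin_gen_im (f := c) Tfg') => [y /mem_imP[x <-]|x _];
    [exists x|exact: mem_im].
apply: le_trans (dim_le_restr S'fg imfg _) _.
  by move=> y /liftA'[x xA' <-]; apply/mem_imP; exists (Sub x (A'T _ xA')).
apply: (dim_im_fin_gen_le (b := corestr (mem_im c))) => //.
- exact: (fin_gen_submod _).1 imfg.
- move=> y /liftA'[x xA' xy]; exists (Sub x (A'T _ xA')) => //.
  exact: val_inj.
- by move=> x; rewrite !mem_restr => /bA'S'.
Qed.

(** The quotient of [M] by the preimage is N/S, so the two ways of expanding tot M by [biv_quot]
    share the term tot(N/S). It is finite since tot M is, and cancels. *)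
Lemma dim_preim M N (f : {linear M -> N}) (S : submodClosed N) :
  (forall y, exists x, f x = y) -> tot M \is a fin_num ->
  d (preim_submod f S) = d S + d (ker_submod f).
Proof.
move=> fsurj Mfin; have := total_surj fsurj.
rewrite [tot M](biv_quot dP (preim_submod f S)) [tot N](biv_quot dP S).
rewrite -/(tot _) (total_quotE (f := quot_pi S \o f)); last 2 first.
- move=> u; have [y <-] := quot_pi_surj u; have [x <-] := fsurj y.
  by exists x.
- by move=> x; rewrite mem_preim; split=> /quot_pi_eq0.
rewrite addeA [d (ker_submod f) + _]addeC.
have Nfin : tot N \is a fin_num.
  move: Mfin; rewrite !ge0_fin_numE ?total_ge0//.
  exact/le_lt_trans/(total_surj_le fsurj).
have qfin := total_quot_fin_num S Nfin.
by move/(congr1 (fun x => x - tot (quotmod S))); rewrite !addeK.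
Qed.
End BivariantTheory.

(** The slack c - x is taken off [y]; for infinite [c] any finite [z] below [y] will do. This lets a
    kernel be replaced by a finitely generated part of it. *)
Lemma ereal_gap (K : realType) (x y c : \bar K) :
  x \is a fin_num -> y \is a fin_num -> (x < c)%E ->
  exists2 z, (z < y)%E & forall s, (z < s)%E -> (x + y < s + c)%E.
Proof.
case: x y => [x||] [y||] // _ _; case: c => [c||] //.
  rewrite lte_fin => xc; exists (y - (c - x))%:E.
    by rewrite lte_fin gtrBl subr_gt0.
  case=> [s||] //; last by rewrite addye // -EFinD => _; exact: ltry.
  by rewrite -!EFinD !lte_fin opprB addrA ltrBlDr addrC.
move=> _; exists (y - 1)%:E; first by rewrite lte_fin gtrBl.
by case=> [s||] //= _; rewrite -EFinD ltry.
Qed.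

(** * From bivariant dimensions to map ranks *)

Section RankOfDimension.
Variables (R : pzRingType) (K : realType) (d : bivariant_fun R K).
Hypothesis dP : bivariant_rank d.
Implicit Types M N P : lmodType R.
Local Open Scope ereal_scope.

(** The zero image is generated by the empty family, so [dim_fin_gen_le] bounds its dimension in [N]
    by that of the zero module. *)
Lemma dim_im_zero M N : d (im_submod (\0%R : {linear M -> N})) = 0.
Proof.
set S := im_submod _.
have S0 y : y \in S -> y = 0%R by case/mem_imP => x <-.
have Sfg : fin_gen S.
  exists 0%N, (fun=> 0%R) => y; split=> [/S0 ->|[c ->]].
    by exists (fun=> 0%R); rewrite big_ord0.
  by rewrite big_ord0 rpred0.
apply/eqP; rewrite eq_le (biv_ge0 dP) andbT.
apply: le_trans (dim_fin_gen_le dP Sfg) _; rewrite (biv_zero dP) // => y.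
by apply: val_inj; exact: S0 (valP y).
Qed.

Section Limits.
Variables (J : Type) (le : J -> J -> Prop).
Hypothesis dir : directed le.
Variables (D : direct_system R le) (L : lmodType R).
Variable b : forall j, {linear D j -> L}.
Hypothesis bP : is_direct_limit b.

(** The images of the [a j] lie in that of [a_lim], which gives the upper bounds. For the lower
    ones, [biv_sup] supplies a finitely generated [S], and its generators are all reached at one
    stage. *)
Lemma dim_im_lim_dom N (a : forall j, {linear D j -> N}) (a_lim : {linear L -> N}) :
  cocone a -> (forall j, a_lim \o b j =1 a j) ->
  d (im_submod (a j)) @[j --> tails le] --> d (im_submod a_lim).
Proof.
move=> aP a_limP; apply: cvg_tails_ge0 => //; first exact: biv_ge0 dP _ _.
  move=> c; rewrite (biv_sup dP) => /ereal_sup_gt[_ [S [Sfg Sim] <-] cS].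
  have [n [g [gS gmin]]] := fin_gen_gens Sfg.
  have /choice[h hP] : forall i, exists j, exists x, a j x = g i.
    move=> i; have /Sim/mem_imP[y <-] := gS i.
    by have [j [x <-]] := direct_limit_surj dir bP y; exists j, x; rewrite -a_limP.
  have [k hk] := directed_bound_fin h dir; exists k => l kl.
  apply: lt_le_trans cS (dim_mono dP _); apply: gmin => i.
  have [x <-] := hP i; have hl := directed_trans dir (hk i) kl.
  by rewrite -(cocone_map aP hl) mem_im.
move=> c cP; have [j0 _] := directed_inhabited dir; exists j0 => j _.
apply: le_lt_trans cP; apply: (dim_mono dP) => _ /mem_imP[x <-].
by rewrite -a_limP /= mem_im.
Qed.

(* A finitely generated T between im a_lim and L is the image of some
   W = M (+) W', with W' contained in D j0.  Its images T_k in D k, k >= j0,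
   satisfy d(im a_k | T_k) = d(A + K_k | W) - d(K_k | W), where A is the preimage
   of im a_lim and the kernels K_k of W -> T_k exhaust the kernel of W -> T. *)
Lemma dim_im_lim_cod M (a : forall j, {linear M -> D j}) (a_lim : {linear M -> L}) :
  fin_gen_mod M -> (forall j k (h : le j k), ds_map D h \o a j =1 a k) ->
  (forall j, b j \o a j =1 a_lim) ->
  d (im_submod (a j)) @[j --> tails le] --> d (im_submod a_lim).
Proof.
move=> Mfg aP a_limP; have bC : cocone b by case: bP.
have bD j k (h : le j k) x := cocone_map bC h x.
have aD j k (h : le j k) x : ds_map D h (a j x) = a k x by exact: aP.
have ba j x : b j (a j x) = a_lim x by exact: a_limP.
(* Pushing forward lowers dimensions, so the net decreases and stays above its candidate limit; a
   single index with value below [c] will be enough. *)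
have le_lim j : d (im_submod a_lim) <= d (im_submod (a j)).
  apply: (dim_im_le dP (b := b j)) => _ /mem_imP[x <-].
  by exists (a j x); rewrite ?mem_im.
have le_step j k : le j k -> d (im_submod (a k)) <= d (im_submod (a j)).
  move=> h; apply: (dim_im_le dP (b := ds_map D h)) => _ /mem_imP[x <-].
  by exists (a j x); rewrite ?mem_im.
apply: cvg_tails_ge0 => // [|c cP|c]; first exact: biv_ge0 dP _ _.
  have [j0 _] := directed_inhabited dir; exists j0 => j _.
  exact: lt_le_trans cP _.
suff : d (im_submod a_lim) < c -> exists j, d (im_submod (a j)) < c.
  move=> H /H[j jc]; exists j => k jk; exact: le_lt_trans (le_step _ _ jk) jc.
have imfg : fin_gen (im_submod a_lim).
  apply: (fin_gen_im (f := a_lim) Mfg) => [_ /mem_imP[x <-]|x _].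
    by exists x.
  exact: mem_im.
rewrite (biv_inf dP) // => /ereal_inf_lt[_ [T [Tfg imT] <-] Tc].
have [n [t [tT tmin]]] := fin_gen_gens Tfg.
have /choice[h hP] : forall i, exists j, exists x, b j x = t i.
  by move=> i; have [j [x <-]] := direct_limit_surj dir bP (t i); exists j, x.
have [j0 hj0] := directed_bound_fin h dir.
have /choice[g gP] : forall i, exists x, b j0 x = t i.
  by move=> i; have [x <-] := hP i; exists (ds_map D (hj0 i) x).
pose W' := span_submod g.
pose W : lmodType R := (M * submod W')%type.
have Wfin : total_dim d W \is a fin_num.
  rewrite (total_prod dP) fin_numD (total_fin_num dP Mfg) (total_fin_num dP) //.
  exact: (fin_gen_submod _).1 (fin_gen_span g).
have w0_lin : linear (fun u : W => a j0 u.1 + val u.2)%R.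
  by move=> e u v; rewrite linearP /= scalerDr addrACA.
pose w0 := mk_linear w0_lin.
have wT u : b j0 (w0 u) \in T.
  case: u => m [y yW']; rewrite /= linearD ba rpredD //; first exact/imT/mem_im.
  rewrite -mem_preim; apply: span_subset yW' => i; rewrite mem_preim gP; exact: tT.
pose w := corestr (f := b j0 \o w0) wT.
(* The generators of [T] are the images under [b j0] of the [g i]. *)
have wsurj y : exists u, w u = y.
  have /mem_imP[u uy] : val y \in im_submod (b j0 \o w0); last first.
    by exists u; apply: val_inj.
  apply: tmin (valP y) => i; rewrite -gP.
  apply/mem_imP; exists (0%R, Sub (g i) (mem_span g i)).
  by rewrite /= linear0 add0r.
set Q := restr_submod (im_submod a_lim) T in Tc.
have Qeq := dim_preim dP Q wsurj Wfin.
(* The preimage of [Q] has dimension below d(ker w) + c. Some finitely generated [S] in ker w keeps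
   this strict inequality, and its generators all vanish at one late stage [k]. *)
have [k [jk kP]] : exists k (jk : le j0 k),
    d (preim_submod w Q) < d (ker_submod (ds_map D jk \o w0)) + c.
  have kfin := dim_fin_num dP (ker_submod w) Wfin.
  have [S [Sfg Sker Sd]] : exists S : submodClosed W,
      [/\ fin_gen S, {subset S <= ker_submod w} & d (preim_submod w Q) < d S + c].
    have [|z zlt zP] := ereal_gap _ kfin Tc.
      by rewrite ge0_fin_numE ?(biv_ge0 dP) // (lt_le_trans Tc) // leey.
    move: zlt; rewrite [X in _ < X](biv_sup dP) => /ereal_sup_gt[_ [S [Sfg Sker] <-] zS].
    by exists S; split=> //; rewrite Qeq; exact: zP.
  have [m [s [sS smin]]] := fin_gen_gens Sfg.
  have /choice[p pP] : forall i, exists k, exists h : le j0 k, ds_map D h (w0 (s i)) = 0%R.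
    move=> i; apply: (direct_limit_ker dir bP).
    by have /Sker/mem_kerP/(congr1 val) := sS i.
  have [l lP] := directed_bound_fin p dir.
  have [k [jk lk]] := directed_bound dir j0 l.
  exists k, jk; apply: lt_le_trans Sd _; rewrite leeD2r //.
  apply: (dim_mono dP); apply: smin => i; apply/mem_kerP.
  have [hi hi0] := pP i; have pk := directed_trans dir (lP i) lk.
  by rewrite /= -(ds_map_comp hi pk) hi0 linear0.
exists k; set v := ds_map D jk \o w0 in kP.
(* It suffices to measure im(a k) inside im v, since passing to the larger module [D k] can only
   lower its dimension. *)
apply: le_lt_trans (_ : d (restr_submod (im_submod (a k)) (im_submod v)) < c).
  apply: (dim_im_le dP (b := submod_incl (im_submod v))) => y yim.
  have yv : y \in im_submod v.
    have /mem_imP[x <-] := yim; apply/mem_imP; exists (x, 0%R).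
    by rewrite /= addr0 aD.
  by exists (Sub y yv).
have vsurj (y : submod (im_submod v)) : exists u, corestr (mem_im v) u = y.
  by have /mem_imP[u uy] := valP y; exists u; apply: val_inj.
have := dim_preim dP (restr_submod (im_submod (a k)) (im_submod v)) vsurj Wfin.
set Q' := restr_submod (im_submod (a k)) (im_submod v) => Q'eq.
(* If v u = a k x, applying [b k] gives w u = a_lim x, so the preimage of [Q'] lies in that of
   [Q]. *)
have : d Q' + d (ker_submod (corestr (mem_im v))) <= d (preim_submod w Q).
  rewrite -Q'eq; apply: (dim_mono dP) => u; rewrite !mem_preim => /mem_imP[x xv].
  apply/mem_imP; exists x; rewrite /= -(ba k x) xv /=; exact: bD.
rewrite (_ : ker_submod (corestr (mem_im v)) = ker_submod v); last first.
  apply: submod_ext => u; apply/mem_kerP/mem_kerP => [/(congr1 val) //|uv].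
  exact: val_inj.
have vfin := dim_fin_num dP (ker_submod v) Wfin.
move=> /le_lt_trans/(_ kP); rewrite addeC lteD2lE //.
Qed.
End Limits.

Lemma extended_map_rank_of_dim : extended_map_rank (rk_of_dim d).
Proof.
split.
- by move=> M N f; exact: biv_ge0 dP _ _.
- exact: dim_im_zero.
- rewrite /rk_of_dim -(biv_one dP); congr (d _); apply: submod_ext => x.
  by rewrite mem_top; apply/mem_imP; exists x.
(* im(b \o a) is the image of im a under [b], and it is contained in im b. *)
- move=> M N P a b; rewrite le_min; apply/andP; split.
    apply: (dim_im_le dP (b := b)) => _ /mem_imP[x <-].
    by exists (a x); rewrite ?mem_im.
  apply: (dim_mono dP) => _ /mem_imP[x <-]; exact: mem_im.
- move=> M N M' N' a b; rewrite /rk_of_dim -(biv_sum dP); congr (d _).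
  apply: submod_ext => -[y y']; rewrite mem_prod /=; apply/mem_imP/andP.
    by case=> -[x x'] [<- <-]; split; exact: mem_im.
  by case=> /mem_imP[x <-] /mem_imP[x' <-]; exists (x, x').
- by move=> J le dir D L b bP N a a_lim; exact: dim_im_lim_dom.
- by move=> J le dir D L b bP M a a_lim; exact: dim_im_lim_cod.
- move=> M N a; rewrite /rk_of_dim.
  have im_id (P : lmodType R) : im_submod (idfun : {linear P -> P}) = top_submod P.
    by apply: submod_ext => x; rewrite mem_top; apply/mem_imP; exists x.
  by rewrite !im_id; exact: biv_quot dP _ _.
Qed.
End RankOfDimension.

(** * Dimensions of map rank functions *)

(** The sum of [S] and [T], spanned by the concatenated generators. It provides the bounds in
    directed families; minimality keeps them below a given submodule. *)
Lemma fin_gen_join (R : pzRingType) (M : lmodType R) (S T : submodClosed M) :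
  fin_gen S -> fin_gen T -> exists V : submodClosed M,
    [/\ fin_gen V, {subset S <= V}, {subset T <= V} &
      forall X : submodClosed M, {subset S <= X} -> {subset T <= X} ->
        {subset V <= X}].
Proof.
move=> /fin_genP[m [g ->]] /fin_genP[n [h ->]].
pose gh (i : 'I_(m + n)) := match fintype.split i with inl j => g j | inr j => h j end.
exists (span_submod gh); split; first exact: fin_gen_span.
- apply: span_subset => i; have := mem_span gh (unsplit (inl i)).
  by rewrite /gh unsplitK.
- apply: span_subset => i; have := mem_span gh (unsplit (inr i)).
  by rewrite /gh unsplitK.
- move=> X gX hX; apply: span_subset => i; rewrite /gh.
  by case: fintype.split => j; [apply/gX/mem_span|apply/hX/mem_span].
Qed.

Lemma fin_gen_line (R : pzRingType) (M : lmodType R) (x : M) :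
  exists V : submodClosed M, [/\ fin_gen V, x \in V &
    forall X : submodClosed M, x \in X -> {subset V <= X}].
Proof.
exists (span_submod (fun _ : 'I_1 => x)); split; first exact: fin_gen_span.
  exact: (mem_span (fun=> x) ord0).
by move=> X xX; apply: span_subset.
Qed.

Lemma fin_gen_zero (R : pzRingType) (M : lmodType R) :
  exists V : submodClosed M, fin_gen V /\ forall X : submodClosed M, {subset V <= X}.
Proof.
exists (span_submod (fun _ : 'I_0 => 0)); split; first exact: fin_gen_span.
by move=> X; apply: span_subset => -[].
Qed.

Section SubmoduleSystems.
Variables (R : pzRingType) (M : lmodType R) (J : Type) (U : J -> submodClosed M).

(** Indices are compared through their submodules, hence only preordered, which [directed]
    permits. *)
Definition submod_le (j k : J) : Prop := {subset U j <= U k}.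

Lemma submod_system_id j (h : submod_le j j) : submod_widen h =1 id.
Proof. by move=> x; apply: val_inj. Qed.

Lemma submod_system_comp i j k (hij : submod_le i j) (hjk : submod_le j k)
    (hik : submod_le i k) : submod_widen hjk \o submod_widen hij =1 submod_widen hik.
Proof. by move=> x; apply: val_inj. Qed.

Definition submod_system : direct_system R submod_le :=
  DirectSystem submod_system_id submod_system_comp.
End SubmoduleSystems.

Section DimensionOfRank.
Variables (R : pzRingType) (K : realType) (rk : map_fun R K).
Hypothesis rkP : extended_map_rank rk.
Implicit Types M N P : lmodType R.
Local Open Scope ereal_scope.

Let d := dim_of_rk rk.

(** Two uses of [emr_comp]. Equalities of ranks below often come from factoring each map through the
    other. *)
Lemma rk_factor M N M' N' (f : {linear M -> N}) (g : {linear M' -> N'})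
    (p : {linear M -> M'}) (q : {linear N' -> N}) :
  (forall x, f x = q (g (p x))) -> rk f <= rk g.
Proof.
move=> fE; have -> : f = q \o (g \o p) by apply: linear_ext.
have := emr_comp rkP (g \o p) q; rewrite le_min => /andP[+ _].
have := emr_comp rkP p g; rewrite le_min => /andP[_ gp] qgp.
exact: le_trans qgp gp.
Qed.

(** [submod (top_submod M)] is only isomorphic to [M], so the inclusion and the identity are
    factored through each other. *)
Lemma total_dim_of_rk M : total_dim d M = rk (idfun : {linear M -> M}).
Proof.
apply/eqP; rewrite eq_le; apply/andP; split.
  exact: (rk_factor (p := submod_incl _) (q := idfun)).
exact: (rk_factor (p := corestr (f := idfun) (@mem_top R M)) (q := idfun)).
Qed.

Section Sup.
Variables (M : lmodType R) (S : submodClosed M).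
Let J := {T : submodClosed M | fin_gen T /\ {subset T <= S}}.
Let U (j : J) := sval j.
Let US j : {subset U j <= S} := (svalP j).2.

Lemma fin_gen_below_directed : directed (submod_le U).
Proof.
split=> [|j //|i j k ij jk x /ij/jk //|[V [Vfg VS]] [W [Wfg WS]]].
  have [V [Vfg Vmin]] := fin_gen_zero M.
  by exists (exist _ V (conj Vfg (Vmin S))).
have [X [Xfg VX WX Xmin]] := fin_gen_join Vfg Wfg.
by exists (exist _ X (conj Xfg (Xmin S VS WS))).
Qed.

(** [S] is the directed union of its finitely generated submodules, so [emr_lim_dom] makes d S a
    limit of members of the supremum. *)
Lemma dim_of_rk_sup : d S = ereal_sup [set d S' | S' in
  [set S' : submodClosed M | fin_gen S' /\ {subset S' <= S}]].
Proof.
apply/eqP; rewrite eq_le; apply/andP; split; last first.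
  apply: ge_ereal_sup => _ [T [_ TS] <-].
  exact: (rk_factor (p := submod_widen TS) (q := idfun)).
pose b j := submod_widen (@US j).
have dir := fin_gen_below_directed.
have bP : is_direct_limit (M := submod_system U) b.
  apply: direct_union_is_limit => // [j k h x|y|j x y /(congr1 val) /= xy].
  - exact: val_inj.
  - have [V [Vfg yV Vmin]] := fin_gen_line (val y).
    exists (exist _ V (conj Vfg (Vmin S (valP y)))), (Sub (val y) yV).
    exact: val_inj.
  - exact: val_inj.
have := emr_lim_dom rkP dir bP (a := fun j => submod_incl (U j))
  (a_lim := submod_incl S) _ _.
move=> cvg; have F := tails_proper dir.
apply: (cvge_le _ (cvg _ _)) => //.
have [j _] := directed_inhabited dir; exists j => k _.
by apply: ereal_sup_ubound; exists (U k) => //; exact: svalP k.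
Qed.
End Sup.

Section Inf.
Variables (P M : lmodType R) (f : {linear P -> M}).
Hypothesis Pfg : fin_gen_mod P.
Let J := {T : submodClosed M | fin_gen T /\ forall x, f x \in T}.
Let U (j : J) := sval j.
Let fU j : forall x, f x \in U j := (svalP j).2.

Lemma fin_gen_above_directed : directed (submod_le U).
Proof.
split=> [|j //|i j k ij jk x /ij/jk //|[V [Vfg fV]] [W [Wfg fW]]].
  have fim : fin_gen (im_submod f).
    by apply: (fin_gen_im (f := f) Pfg) => [y /mem_imP[x <-]|x _];
      [exists x|exact: mem_im].
  by exists (exist _ (im_submod f) (conj fim (mem_im f))).
have [X [Xfg VX WX _]] := fin_gen_join Vfg Wfg.
have fX x : f x \in X by apply/VX/fV.
by exists (exist _ X (conj Xfg fX)).
Qed.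

(** [M] is the directed union of the finitely generated submodules containing im f. An arbitrary [f]
    is allowed, as [rk_im_fin_gen_dom] needs more than inclusions. *)
Lemma rk_cvg_above : rk (corestr (@fU j)) @[j --> tails (submod_le U)] --> rk f.
Proof.
have dir := fin_gen_above_directed.
apply: (emr_lim_cod rkP dir (D := submod_system U) (b := fun j => submod_incl (U j))) => //.
- apply: direct_union_is_limit => // y.
  have [V [Vfg yV _]] := fin_gen_line y.
  have [j _] := directed_inhabited dir.
  have [X [Xfg jX VX _]] := fin_gen_join (svalP j).1 Vfg.
  have fX x : f x \in X by apply/jX/fU.
  by exists (exist _ X (conj Xfg fX)), (Sub y (VX _ yV)).
- by move=> j k h x; apply: val_inj.
Qed.

Lemma rk_ge_above (c : \bar K) :
  (forall (T : submodClosed M) (fT : forall x, f x \in T), fin_gen T ->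
    c <= rk (corestr fT)) -> c <= rk f.
Proof.
move=> cle; have F := tails_proper fin_gen_above_directed.
apply: (cvge_ge _ rk_cvg_above).
have [j _] := directed_inhabited fin_gen_above_directed; exists j => k _.
by apply: cle; exact: (svalP k).1.
Qed.
End Inf.

Lemma dim_of_rk_inf M (S : submodClosed M) : fin_gen S ->
  d S = ereal_inf [set d (restr_submod S T) | T in
    [set T : submodClosed M | fin_gen T /\ {subset S <= T}]].
Proof.
move=> Sfg; apply/eqP; rewrite eq_le; apply/andP; split.
  apply: le_ereal_inf_tmp => _ [T [_ ST] <-].
  have ST' x : submod_widen ST x \in restr_submod S T by rewrite mem_restr (valP x).
  exact: (rk_factor (p := corestr ST') (q := submod_incl T)).
apply: rk_ge_above => [|T ST Tfg]; first exact: (fin_gen_submod S).1.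
apply: (@le_trans _ _ (d (restr_submod S T))).
  by apply: ereal_inf_lbound; exists T => //; split=> // x xS; exact: (ST (Sub x xS)).
(* [submod (restr_submod S T)] and [submod S] are different copies of the same module; the
   corestricted inclusion passes from one to the other. *)
have rS (x : submod (restr_submod S T)) :
  (submod_incl T \o submod_incl _) x \in S by exact: valP x.
by apply: (rk_factor (p := corestr rS) (q := idfun)) => x; apply: val_inj.
Qed.

Lemma bivariant_rank_of_rk : bivariant_rank d.
Proof.
split.
- by move=> M S; exact: emr_ge0 rkP _ _ _.
- move=> M N S T f [g fK gK] fST.
  have g_lin : linear g.
    by move=> a u v; apply: (can_inj fK); rewrite linearP !gK.
  apply/eqP; rewrite eq_le; apply/andP; split.
    have fS x : (f \o submod_incl S) x \in T by rewrite /= fST (valP x).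
    by apply: (rk_factor (p := corestr fS) (q := mk_linear g_lin)) => x /=; rewrite fK.
  have gT x : (mk_linear g_lin \o submod_incl T) x \in S.
    by rewrite -fST /= gK (valP x).
  by apply: (rk_factor (p := corestr gT) (q := f)) => x /=; rewrite gK.
- move=> M M0; rewrite total_dim_of_rk -(emr_zero rkP M M); congr (rk _).
  by apply: linear_ext => x; exact: M0.
- by rewrite total_dim_of_rk; exact: emr_one rkP.
- move=> M N S T; rewrite /d /dim_of_rk -(emr_sum rkP).
  (* The submodule of the product and the product of the submodules are isomorphic but distinct
     types, so each inclusion is factored through the other. *)
  apply/eqP; rewrite eq_le; apply/andP; split.
    have p1 (u : submod (prod_submod S T)) : (val u).1 \in S.
      by have := valP u; rewrite mem_prod => /andP[].
    have p2 (u : submod (prod_submod S T)) : (val u).2 \in T.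
      by have := valP u; rewrite mem_prod => /andP[].
    have p_lin : linear (fun u : submod (prod_submod S T) =>
        (Sub (val u).1 (p1 u), Sub (val u).2 (p2 u)) : submod S * submod T).
      by move=> a u v; congr (_, _); apply: val_inj.
    apply: (rk_factor (p := mk_linear p_lin) (q := idfun)) => u /=.
    by rewrite /prod_fun /=; case: (val u).
  have pST u : prod_map (submod_incl S) (submod_incl T) u \in prod_submod S T.
    by rewrite mem_prod; apply/andP; split; exact: valP.
  exact: (rk_factor (p := corestr pST) (q := idfun)).
- exact: dim_of_rk_sup.
- exact: dim_of_rk_inf.
- move=> M S; have := emr_coker rkP (submod_incl S).
  rewrite -!total_dim_of_rk /coker (_ : im_submod _ = S) //.
  apply: submod_ext => x; apply/mem_imP/idP => [[y <-]|xS]; first exact: valP.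
  by exists (Sub x xS).
Qed.

(** [emr_coker] and [biv_quot] split total_dim d N with the same cokernel term, finite by the theory
    of bivariant dimensions and hence cancelled. *)
Lemma rk_im_fin_gen_cod M N (f : {linear M -> N}) : fin_gen_mod N ->
  rk f = d (im_submod f).
Proof.
move=> Nfg; have dP := bivariant_rank_of_rk.
have Nfin := total_fin_num dP Nfg.
have := emr_coker rkP f; rewrite -!total_dim_of_rk (biv_quot dP (im_submod f)).
have qfin := total_quot_fin_num dP (im_submod f) Nfin.
by move/(congr1 (fun x => x - total_dim d (coker f))); rewrite !addeK.
Qed.

(** At each finitely generated [T] containing im f, the corestriction has as rank the dimension of
    its image in [T], which is at least that in [N]. *)
Lemma rk_im_fin_gen_dom M N (f : {linear M -> N}) : fin_gen_mod M ->
  d (im_submod f) <= rk f.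
Proof.
move=> Mfg; have dP := bivariant_rank_of_rk.
apply: rk_ge_above => // T fT Tfg.
rewrite rk_im_fin_gen_cod; last exact: (fin_gen_submod T).1.
apply: (dim_im_le dP (b := submod_incl T)) => _ /mem_imP[x <-].
by exists (corestr fT x); rewrite ?mem_im.
Qed.

(** [f] factors through the inclusion of its image. Conversely, a finitely generated [S] in im f
    lifts to a finitely generated [A], and d S <= rk (f restricted to [A]) <= rk f. *)
Lemma rk_im M N (f : {linear M -> N}) : d (im_submod f) = rk f.
Proof.
have dP := bivariant_rank_of_rk.
apply/eqP; rewrite eq_le; apply/andP; split; last first.
  by apply: (rk_factor (p := corestr (mem_im f)) (q := idfun)).
rewrite [leLHS](biv_sup dP); apply: ge_ereal_sup => _ [S [Sfg Sim] <-].
have [|A [Afg _ lift fA]] := fin_gen_lift Sfg (f := f) (A := top_submod M).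
  by move=> y /Sim/mem_imP[x <-]; exists x.
apply: le_trans (_ : rk (f \o submod_incl A) <= _); last first.
  exact: (rk_factor (p := submod_incl A) (q := idfun)).
have := rk_im_fin_gen_dom (f \o submod_incl A) ((fin_gen_submod A).1 Afg).
apply: le_trans; apply: (dim_mono dP) => y /lift[x xA <-].
by apply/mem_imP; exists (Sub x xA).
Qed.
End DimensionOfRank.

Theorem theorem6p2 (R : pzRingType) (K : realType) :
  [/\ (forall rk : map_fun R K,
         extended_map_rank rk -> bivariant_rank (dim_of_rk rk)),
      (forall d : bivariant_fun R K,
         bivariant_rank d -> extended_map_rank (rk_of_dim d)),
      (forall rk : map_fun R K,
         extended_map_rank rk -> rk_of_dim (dim_of_rk rk) = rk) &
      (forall d : bivariant_fun R K,
         bivariant_rank d -> dim_of_rk (rk_of_dim d) = d)].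
Proof.
split; [exact: bivariant_rank_of_rk|exact: extended_map_rank_of_dim| |].
  move=> rk rkP; do 3!apply: functional_extensionality_dep => ?.
  exact: rk_im.
(* The image of the inclusion of [S] is [S] itself. *)
move=> d _; apply: functional_extensionality_dep => M.
apply: functional_extensionality_dep => S; congr (d _); apply: submod_ext => x.
apply/mem_imP/idP => [[y <-]|xS]; first exact: valP.
by exists (Sub x xS).
Qed.
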